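(* Denote $\kappa=\min\{\bar\kappa_{\text{in-in}},\bar\kappa_{\text{in-out}}\}$. Assume that $m>n\ge5$ and $d\ge16\log(nm)$. Then there exists a triplet $(\sigma^\#,\theta^\#,\pi^* )$ such that $6\kappa\ge(d\log(nm))^{1/4}$ and $$\inf_{\hat\pi}\ \mathbf P_{\theta^\#,\sigma^\#,\pi^*}\big(\hat\pi\ne\pi^*\big)>\frac13,$$ where the infimum is taken over all injective matching maps $[n]\to[m]$ (that is, over all estimators $\hat\pi$ of $\pi^*$ with values in the set of injective maps $[n]\to[m]$).
   Context: Notation: $[n]=\{1,\dots,n\}$; $\|\cdot\|$ is the Euclidean norm on $\mathbb R^d$. Model. Let $m>n$ and $d\ge1$ be integers. The parameters are $\theta^\#=(\theta^\#_1,\dots,\theta^\#_m)$ with $\theta^\#_j\in\mathbb R^d$, $\sigma^\#=(\sigma^\#_1,\dots,\sigma^\#_m)$ with $\sigma_j^\#>0$, and an injective map $\pi^*:[n]\to[m]$. For $i\in[n]$ put $\theta_i=\theta^\#_{\pi^*(i)}$ and $\sigma_i=\sigma^\#_{\pi^*(i)}$. One observes $$X_i=\theta_i+\sigma_i\xi_i\ (i\in[n]),\qquad X^\#_j=\theta^\#_j+\sigma^\#_j\xi^\#_j\ (j\in[m]),$$ where $\xi_1,\dots,\xi_n,\xi^\#_1,\dots,\xi^\#_m$ are independent standard Gaussian vectors in $\mathbb R^d$ (zero mean, identity covariance). The law of $(X_1,\dots,X_n,X_1^\#,\dots,X_m^\#)$ is denoted $\mathbf P_{\theta^\#,\sigma^\#,\pi^*}$.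 The outlier index set is $O_{\pi^*}=[m]\setminus\mathrm{Im}(\pi^* )$. An estimator of $\pi^*$ is a measurable function of the observations $(X_1,\dots,X_n,X^\#_1,\dots,X^\#_m)$ with values in the set of injective maps $[n]\to[m]$. Separation distances (depending on the triplet $(\sigma^\#,\theta^\#,\pi^* )$): $$\bar\kappa_{\text{in-in}}=\min_{\substack{i,j\notin O_{\pi^*}\\ i\ne j}}\frac{\|\theta^\#_i-\theta^\#_j\|}{((\sigma^\#_i)^2+(\sigma^\#_j)^2)^{1/2}},\qquad \bar\kappa_{\text{in-out}}=\min_{\substack{i\notin O_{\pi^*}\\ j\in O_{\pi^*}}}\frac{\|\theta^\#_i-\theta^\#_j\|}{((\sigma^\#_i)^2+(\sigma^\#_j)^2)^{1/2}}.$$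
   Formalization: For a triplet fixed before the infimum the claim is false (the constant estimator π̂=π* has error 0); what is proved is the minimax form: the infimum over estimators of the supremum of the error over all triplets with 6κ≥(d log(nm))^{1/4} is >1/3. *)

(* Defs.v *)
(* MathComp-Analysis *)
From HB Require Import structures.
From mathcomp Require Import all_boot all_order all_algebra.
From mathcomp Require Import all_classical all_reals all_analysis.
From mathcomp Require Import measurable_realfun.

Set Implicit Arguments.
Unset Strict Implicit.
Unset Printing Implicit Defensive.

Import Order.TTheory GRing.Theory Num.Theory.
Import numFieldNormedType.Exports.

Local Open Scope classical_set_scope.
Local Open Scope ring_scope.

Section iid_vectors.
Context {disp : measure_display} {T : measurableType disp} {R : realType}.

Definition tuple_cons n (x : T * n.-tuple T) : n.+1.-tuple T :=
  [tuple of x.1 :: x.2].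

Lemma measurable_tuple_cons n : measurable_fun setT (@tuple_cons n).
Proof. exact: (measurable_cons measurable_fst measurable_snd). Qed.

HB.instance Definition _ n :=
  isMeasurableFun.Build _ _ _ _ (@tuple_cons n) (@measurable_tuple_cons n).

(* The n-fold product of P, i.e., the law of n independent draws from P. *)
Fixpoint iid (P : probability T R) (n : nat) : probability (n.-tuple T) R :=
  match n with
  | 0 => dirac [tuple]
  | n'.+1 => distribution (P \x iid P n')%E (@tuple_cons n')
  end.

End iid_vectors.

Section matching.
Context {R : realType}.

(* lebesgue_measure and normal_prob live on measurableTypeR R, which is R with
   its Borel sets; tuples carry the product sigma-algebra. *)
Definition vec d := d.-tuple (measurableTypeR R).

Definition sample n m d : Type := n.-tuple (vec d) * m.-tuple (vec d).

Definition injection n m := {f : {ffun 'I_n -> 'I_m} | injectiveb f}.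

Record triplet n m d := Triplet {
  theta : 'I_m -> 'rV[R]_d;
  sigma : 'I_m -> R;
  sigma_gt0 : forall j, 0 < sigma j;
  pistar : injection n m }.

(* `|x| on 'rV[R]_d is the sup norm. *)
Definition norm2 d (x : 'rV[R]_d) : R := Num.sqrt (\sum_(k < d) x 0 k ^+ 2).

Section law.
Context {n m d : nat}.
Variable t : triplet n m d.

Definition outliers : {set 'I_m} := ~: [set sval (pistar t) i | i : 'I_n].

Definition separation (i j : 'I_m) : R :=
  norm2 (theta t i - theta t j) / Num.sqrt (sigma t i ^+ 2 + sigma t j ^+ 2).

(* +oo is the neutral element of min; both minima range over a nonempty set
   when 2 <= n < m. *)
Definition kappa_in_in : \bar R :=
  \big[Order.min/+oo%E]_(p : 'I_m * 'I_m |
      [&& p.1 \notin outliers, p.2 \notin outliers & p.1 != p.2])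
    (separation p.1 p.2)%:E.

Definition kappa_in_out : \bar R :=
  \big[Order.min/+oo%E]_(p : 'I_m * 'I_m |
      (p.1 \notin outliers) && (p.2 \in outliers))
    (separation p.1 p.2)%:E.

Definition kappa : \bar R := Order.min kappa_in_in kappa_in_out.

Definition noisy (j : 'I_m) (z : vec d) : vec d :=
  [tuple theta t j 0 k + sigma t j * (tnth z k : R) | k < d].

Definition observe (xi : sample n m d) : sample n m d :=
  ([tuple noisy (sval (pistar t) i) (tnth xi.1 i) | i < n],
   [tuple noisy j (tnth xi.2 j) | j < m]).

Lemma measurable_noisy j : measurable_fun setT (noisy j).
Proof.
apply/measurable_fun_tnthP => k.
rewrite (_ : _ \o _ =
    fun z : vec d => theta t j 0 k + sigma t j * (tnth z k : R)); last first.
  by apply/funext => z /=; rewrite tnth_mktuple.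
apply: (@measurable_funD _ _ R setT (cst (theta t j 0 k))) => //.
apply: (@measurable_funM _ _ R setT (cst (sigma t j))) => //.
exact: measurable_tnth.
Qed.

Lemma measurable_observe : measurable_fun setT observe.
Proof.
apply/measurable_fun_pairP; split; apply/measurable_fun_tnthP => i.
- rewrite (_ : _ \o _ =
    noisy (sval (pistar t) i) \o ((@tnth n (vec d) ^~ i) \o fst)); last first.
    by apply/funext => z /=; rewrite tnth_mktuple.
  apply: measurableT_comp; first exact: measurable_noisy.
  by apply: measurableT_comp => //; exact: measurable_tnth.
- rewrite (_ : _ \o _ =
    noisy i \o ((@tnth m (vec d) ^~ i) \o snd)); last first.
    by apply/funext => z /=; rewrite tnth_mktuple.
  apply: measurableT_comp; first exact: measurable_noisy.
  by apply: measurableT_comp => //; exact: measurable_tnth.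
Qed.

HB.instance Definition _ :=
  isMeasurableFun.Build _ _ _ _ observe measurable_observe.

End law.

(* Law of a standard Gaussian vector of R^d. *)
Definition gaussian d : probability (vec d) R := iid (normal_prob (0 : R) 1) d.

Definition noise n m d : probability (sample n m d) R :=
  (iid (gaussian d) n \x iid (gaussian d) m)%E.

(* The law of (X_1, ..., X_n, X#_1, ..., X#_m). *)
Definition law n m d (t : triplet n m d) : probability (sample n m d) R :=
  distribution (noise n m d) (observe t).

(* Measurability with respect to the discrete sigma-algebra on the finite set
   of injections. *)
Definition is_estimator n m d (pihat : sample n m d -> injection n m) : Prop :=
  forall Y : set (injection n m), measurable (pihat @^-1` Y).

(* The supremum over the class C is inside the infimum: at a fixed triplet t the
   constant estimator fun=> pistar t makes no error. *)
Definition minimax_error n m d (C : set (triplet n m d)) : \bar R :=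
  ereal_inf [set ereal_sup [set law t [set x | pihat x <> pistar t] | t in C]
            | pihat in @is_estimator n m d].

End matching.

(* Main.v *)
Require Import Defs.
From HB Require Import structures.
From mathcomp Require Import all_boot all_order all_algebra.
From mathcomp Require Import all_classical all_reals all_analysis.
From mathcomp Require Import measurable_realfun zify ring lra.

Set Implicit Arguments.
Unset Strict Implicit.
Unset Printing Implicit Defensive.

Import Order.TTheory GRing.Theory Num.Theory.
Import numFieldNormedType.Exports.

Local Open Scope classical_set_scope.
Local Open Scope ring_scope.

(* Put an independent uniform sign on every coordinate of every center
   [theta_j], of size [tau] with [tau ^ 4 = ln (n * m) / (81 * d)], take all
   noise levels equal to 1 and a uniform injection [p].  Let [Q] be the product
   over all coordinates of the symmetric two-point mixture density.  Averaging
   the likelihood over the signs gives [Q * K_p], where [K_p] is the product of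
   [1 + th x_ik * th y_(p i)k] over [i] and [k], and the second moment of [K_p]
   under [Q] is at most [(1 + tau ^ 4) ^ (n * d) <= exp (n * ln (n * m) / 81)].
   With [N] injections, the pointwise bound [K_p <= N / 4 + K_p ^ 2 / N] on the
   disjoint events [pihat = p] shows that the Bayes success probability is at
   most 1/4 plus this second moment divided by [N], and [N >= m ^ (n / 2)]
   makes the last term at most 1/6.  On the other hand, a Chernoff bound and
   [d >= 16 * ln (n * m)] show that all but a fraction 1/30 of the sign patterns
   have centers at pairwise Hamming distance at least [d / 8], which is the
   required separation.  An estimator with error below 1/2 on every separated
   triplet would have Bayes success probability at least 29/60 > 1/4 + 1/6. *)

(** * Densities and Gaussian shifts *)

Section density.
Context {disp : measure_display} {T : measurableType disp} {R : realType}.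
Variables (mu nu : {measure set T -> \bar R}) (g : T -> R).
Hypotheses (mg : measurable_fun setT g) (g0 : forall x, 0 <= g x).
Hypothesis nuE : forall A, measurable A ->
  nu A = (\int[mu]_(x in A) (g x)%:E)%E.

Import HBNNSimple.
Local Open Scope ereal_scope.

(** Monotone approximation by simple functions reduces the change of measure to indicators, where it
    is [nuE]. *)
Lemma ge0_integral_density (f : T -> \bar R) :
  measurable_fun setT f -> (forall x, 0 <= f x) ->
  \int[nu]_x f x = \int[mu]_x (f x * (g x)%:E).
Proof.
move=> mf f0; pose h := nnsfun_approx measurableT mf.
have hf x : (h n x)%:E @[n --> \oo] --> f x.
  exact: cvg_nnsfun_approx.
transitivity (limn (fun n => \int[nu]_x (h n x)%:E)).
  rewrite -monotone_convergence//.
  - by apply: eq_integral => y _; apply/esym/cvg_lim.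
  - by move=> n; exact/measurable_EFinP/measurable_funP.
  - by move=> n y _; rewrite lee_fin.
  - by move=> y _ a b ab; rewrite lee_fin; exact/lefP/nd_nnsfun_approx.
transitivity (limn (fun n => \int[mu]_x ((h n x)%:E * (g x)%:E))); last first.
  rewrite -monotone_convergence//.
  - apply: eq_integral => y _; apply/cvg_lim => //.
    by apply: cvgeZr.
  - move=> n; apply: emeasurable_funM; apply/measurable_EFinP => //.
  - by move=> n y _; rewrite mule_ge0// lee_fin.
  - move=> y _ a b ab; rewrite lee_wpmul2r ?lee_fin//.
    exact/lefP/nd_nnsfun_approx.
congr (limn _); apply/funext => n.
transitivity (\sum_(k \in range (h n))
    \int[nu]_x (k * \1_(h n @^-1` [set k]) x)%:E).
  under eq_integral do rewrite fimfunE -fsumEFin//.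
  rewrite ge0_integral_fsum//.
  - by move=> y; exact/measurable_EFinP/measurable_funM.
  - by move=> y x _; rewrite nnfun_muleindic_ge0.
transitivity (\sum_(k \in range (h n))
    \int[mu]_x ((k * \1_(h n @^-1` [set k]) x)%:E * (g x)%:E)); last first.
  rewrite -ge0_integral_fsum//.
  - apply: eq_integral => x _; rewrite -ge0_mule_fsuml; last first.
      by move=> k; rewrite nnfun_muleindic_ge0.
    by rewrite fsumEFin// -fimfunE.
  - move=> y; apply: emeasurable_funM; apply/measurable_EFinP => //.
    exact: measurable_funM.
  - by move=> y x _; rewrite mule_ge0// ?lee_fin// -?lee_fin nnfun_muleindic_ge0.
apply: eq_fsbigr => k /set_mem[x _ hx].
have k0 : (0 <= k)%R by rewrite -hx.
under eq_integral do rewrite EFinM.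
under [in RHS]eq_integral do rewrite EFinM -muleA.
rewrite ge0_integralZl_EFin//; last exact/measurable_EFinP.
rewrite ge0_integralZl_EFin//; first last.
- by apply: emeasurable_funM; exact/measurable_EFinP.
- by move=> y _; rewrite mule_ge0// lee_fin.
congr (_ * _); rewrite integral_indic//= setIT nuE// integral_mkcond.
apply: eq_integral => y _; rewrite patchE indicE.
by case: ifP => _; rewrite ?mul1e ?mul0e.
Qed.

End density.

Section gaussian_shift.
Context {R : realType}.
Local Open Scope ereal_scope.
Notation mu := (@lebesgue_measure R).

Let shift (a : R) : measurableTypeR R -> measurableTypeR R := fun x => (a + x)%R.

Lemma measurable_shift (a : R) : measurable_fun setT (shift a).
Proof. exact: (@measurable_funD _ _ R setT (cst a)). Qed.

(** The image of Lebesgue measure under a translation agrees with it on half-open intervals, and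
    these determine the measure. *)
Lemma ge0_integral_lebesgue_shift (a : R) (f : R -> \bar R) :
  measurable_fun setT f -> (forall x, 0 <= f x) ->
  \int[mu]_x f (a + x)%R = \int[mu]_x f x.
Proof.
move=> mf f0.
have ma := measurable_shift a.
transitivity (\int[pushforward mu (shift a)]_x f x).
  by rewrite ge0_integral_pushforward.
apply: eq_measure_integral => A mA _; apply/esym.
apply: (@lebesgue_measure_unique _ (pushforward mu (shift a))) => //= _ [[b c]] _ <-.
rewrite /pushforward/=.
rewrite (_ : _ @^-1` _ = `](b - a)%R, (c - a)%R]%classic); last first.
  apply/seteqP; split => x /=; rewrite !in_itv/=;
    by rewrite ltrBlDl lerBrDl.
rewrite !lebesgue_measure_itv/= !lte_fin ltrD2r -!EFinB.
by rewrite (_ : c - a - (b - a) = c - b)%R//; ring.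
Qed.

(** Cameron-Martin formula in dimension one: the weight at [a + x] times the normal density at
    [a + x] is the normal density at [x]. *)
Lemma ge0_integral_normal_shift (a : R) (f : R -> \bar R) :
  measurable_fun setT f -> (forall x, 0 <= f x) ->
  \int[normal_prob 0 1]_x f (a + x)%R =
  \int[normal_prob 0 1]_x (f x * (expR (a * x - a ^+ 2 / 2))%:E).
Proof.
move=> mf f0.
have mW : measurable_fun setT (fun x : R => expR (a * x - a ^+ 2 / 2)).
  by apply: measurableT_comp => //; apply: measurable_funD.
have mshift := measurable_shift a.
rewrite (@ge0_integral_density _ _ _ mu _ (normal_pdf 0 1))//; first last.
- exact: measurableT_comp.
- exact: normal_pdf_ge0.
- exact: measurable_normal_pdf.
rewrite (@ge0_integral_density _ _ _ mu (normal_prob 0 1)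
  (normal_pdf 0 1))//; first last.
- by move=> x; rewrite mule_ge0// lee_fin expR_ge0.
- by apply: emeasurable_funM => //; exact/measurable_EFinP.
- exact: normal_pdf_ge0.
- exact: measurable_normal_pdf.
rewrite -(@ge0_integral_lebesgue_shift a
   (fun x => f x * (expR (a * x - a ^+ 2 / 2))%:E * (normal_pdf 0 1 x)%:E));
  last 2 first.
- apply: emeasurable_funM; first apply: emeasurable_funM => //.
    exact/measurable_EFinP.
  by apply/measurable_EFinP; exact: measurable_normal_pdf.
- by move=> x; rewrite !mule_ge0 ?lee_fin ?expR_ge0 ?normal_pdf_ge0.
apply: eq_integral => x _; rewrite -muleA -EFinM; congr (_ * _%:E).
rewrite !normal_pdfE ?oner_eq0//= mulrCA; congr (_ * _)%R.
by rewrite /normal_fun -expRD; congr expR; field.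
Qed.

End gaussian_shift.

(** * Integrals against product laws *)

Section iid_integral.
Context {disp : measure_display} {T : measurableType disp} {R : realType}.
Variable P : probability T R.
Local Open Scope ereal_scope.

Lemma ge0_integral_iidS n (f : n.+1.-tuple T -> \bar R) :
  measurable_fun setT f -> (forall x, 0 <= f x) ->
  \int[iid P n.+1]_x f x =
  \int[P]_x \int[iid P n]_y f (tuple_cons (x, y)).
Proof.
move=> mf f0.
transitivity (\int[P \x iid P n]_z (f \o @tuple_cons _ T n) z).
  apply: (@ge0_integral_pushforward _ _ _ _ R (@tuple_cons _ T n)
    (@measurable_tuple_cons _ T n) (P \x iid P n)%E setT f) => //.
apply: (fubini_tonelli1 (f \o @tuple_cons _ T n)) => //=.
by apply: measurableT_comp => //; exact: measurable_tuple_cons.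
Qed.

Lemma measurable_tnth_prod n (h : 'I_n -> T -> R) :
  (forall i, measurable_fun setT (h i)) ->
  measurable_fun setT (fun x : n.-tuple T => (\prod_(i < n) h i (tnth x i))%R).
Proof.
move=> mh.
apply: (@measurable_prod _ (n.-tuple T) R setT _ (index_enum _)
  (fun i x => h i (tnth x i))) => i _.
by apply: (measurableT_comp (mh i)); exact: measurable_tnth.
Qed.

Lemma tnth_tuple_cons0 n (z : T * n.-tuple T) : tnth (tuple_cons z) ord0 = z.1.
Proof. by []. Qed.

Lemma tnth_tuple_consS n (z : T * n.-tuple T) i :
  tnth (tuple_cons z) (lift ord0 i) = tnth z.2 i.
Proof. by rewrite tnthS. Qed.

(** Induction on [n]: with the first coordinate fixed, the others are changed by the induction
    hypothesis; then [FW ord0] applies to the function of the first coordinate obtained by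
    integrating out the others. The maps depend on the index because the centers do. *)
Lemma ge0_integral_iid_density n (F : 'I_n -> T -> T) (W : 'I_n -> T -> R) :
  (forall i, measurable_fun setT (F i)) ->
  (forall i, measurable_fun setT (W i)) -> (forall i x, (0 <= W i x)%R) ->
  (forall i (f : T -> \bar R), measurable_fun setT f -> (forall x, 0 <= f x) ->
    \int[P]_x f (F i x) = \int[P]_x (f x * (W i x)%:E)) ->
  forall f : n.-tuple T -> \bar R,
  measurable_fun setT f -> (forall x, 0 <= f x) ->
  \int[iid P n]_x f [tuple F i (tnth x i) | i < n] =
  \int[iid P n]_x (f x * (\prod_(i < n) W i (tnth x i))%:E).
Proof.
elim: n F W => [|n IH] F W mF mW W0 FW f mf f0.
  apply: eq_integral => x _; rewrite big_ord0 mule1.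
  by rewrite [x]tuple0 [in LHS]tuple0.
have mFt : measurable_fun setT
    (fun x : n.+1.-tuple T => [tuple F i (tnth x i) | i < n.+1]).
  apply/measurable_fun_tnthP => i.
  rewrite (_ : _ \o _ = F i \o (@tnth n.+1 T ^~ i)); last first.
    by apply/funext => x /=; rewrite tnth_mktuple.
  by apply: measurableT_comp => //; exact: measurable_tnth.
rewrite ge0_integral_iidS//; last exact: measurableT_comp.
rewrite ge0_integral_iidS//; first last.
- by move=> x; rewrite mule_ge0// lee_fin prodr_ge0.
- apply: emeasurable_funM => //; apply/measurable_EFinP. exact: measurable_tnth_prod.
have mfc x : measurable_fun setT (fun y => f (tuple_cons (x, y) : n.+1.-tuple T)).
  apply: measurableT_comp => //.
  exact: (measurableT_comp (@measurable_tuple_cons _ T n)).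
have mW' : measurable_fun setT
    (fun x : n.-tuple T => (\prod_(i < n) W (lift ord0 i) (tnth x i))%R).
  exact: (@measurable_tnth_prod n (fun i => W (lift ord0 i))).
(* [G] carries the weights of all coordinates but the first: the situation between the two changes
   of variables. *)
pose G (z : T * n.-tuple T) :=
  f (tuple_cons z) * (\prod_(i < n) W (lift ord0 i) (tnth z.2 i))%:E.
have mG : measurable_fun setT G.
  apply: emeasurable_funM.
    by apply: measurableT_comp => //; exact: measurable_tuple_cons.
  by apply/measurable_EFinP; exact: (measurableT_comp mW').
have G0 z : 0 <= G z by rewrite mule_ge0// lee_fin prodr_ge0.
transitivity (\int[P]_x \int[iid P n]_y G (F ord0 x, y)).
  apply: eq_integral => x _.
  rewrite -(IH (fun i => F (lift ord0 i)) (fun i => W (lift ord0 i))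
    (fun i => mF (lift ord0 i)) (fun i => mW (lift ord0 i))
    (fun i => W0 (lift ord0 i)) (fun i => FW (lift ord0 i))
    (fun y => f (tuple_cons (F ord0 x, y))))//.
  apply: eq_integral => y _; congr f; apply/eq_from_tnth => i.
  rewrite tnth_mktuple; case: (unliftP ord0 i) => [j ->|->] /=.
    by rewrite !tnth_tuple_consS tnth_mktuple.
  by rewrite !tnth_tuple_cons0.
transitivity (\int[P]_x ((\int[iid P n]_y G (x, y)) * (W ord0 x)%:E)).
  apply: (FW ord0 (fun x => \int[iid P n]_y G (x, y))).
    exact: measurable_fun_fubini_tonelli_F.
  by move=> x; apply: integral_ge0.
apply: eq_integral => x _.
rewrite -ge0_integralZr//; last 2 first.
- exact: measurableT_comp.
- by rewrite lee_fin.
apply: eq_integral => y _; rewrite /G -muleA -EFinM big_ord_recl mulrC.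
by congr (_ * (_ * _)%:E); apply: eq_bigr => i _; rewrite tnth_tuple_consS.
Qed.

(** Coordinates are integrated out one at a time. The bounds [c] stand in for exact moments, since
    the second moment argument uses upper bounds only. *)
Lemma le_integral_iid_prod n (g : 'I_n -> T -> R) (c : 'I_n -> R) :
  (forall i, measurable_fun setT (g i)) -> (forall i x, (0 <= g i x)%R) ->
  (forall i, \int[P]_x (g i x)%:E <= (c i)%:E) ->
  \int[iid P n]_x (\prod_(i < n) g i (tnth x i))%:E <= (\prod_(i < n) c i)%:E.
Proof.
elim: n g c => [|n IH] g c mg g0 gc.
  under eq_integral do rewrite big_ord0.
  by rewrite integral_cst//= probability_setT big_ord0 mule1.
have c0 i : (0 <= c i)%R.
  rewrite -lee_fin; apply: le_trans (gc i).
  by apply: integral_ge0 => x _; rewrite lee_fin.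
rewrite ge0_integral_iidS//; last 2 first.
- by apply/measurable_EFinP; exact: measurable_tnth_prod.
- by move=> x; rewrite lee_fin prodr_ge0.
have mg' : measurable_fun setT
    (fun x : n.-tuple T => (\prod_(i < n) g (lift ord0 i) (tnth x i))%R).
  exact: (@measurable_tnth_prod n (fun i => g (lift ord0 i))).
pose I := \int[iid P n]_x (\prod_(i < n) g (lift ord0 i) (tnth x i))%:E.
have I0 : 0 <= I by apply: integral_ge0 => x _; rewrite lee_fin prodr_ge0.
rewrite (_ : \int[P]_x _ = \int[P]_x ((g ord0 x)%:E * I)); last first.
  apply: eq_integral => x _; rewrite -ge0_integralZl//; first last.
  - by rewrite lee_fin.
  - by move=> y _; rewrite lee_fin prodr_ge0.
  - exact/measurable_EFinP.
  apply: eq_integral => y _; rewrite big_ord_recl EFinM.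
  by congr (_ * _%:E); apply: eq_bigr => i _; rewrite tnth_tuple_consS.
rewrite ge0_integralZr//; last 2 first.
- exact/measurable_EFinP.
- by move=> x _; rewrite lee_fin.
rewrite big_ord_recl EFinM lee_pmul//.
- by apply: integral_ge0 => x _; rewrite lee_fin.
- by apply: (IH (fun i => g (lift ord0 i)) (fun i => c (lift ord0 i))).
Qed.

End iid_integral.

(** * The density of the observations *)

Section gaussian_vectors.
Context {R : realType}.
Local Open Scope ereal_scope.

(** Density of the normal law of mean [a] and variance 1 with respect to the standard normal law. *)
Definition shift_density (a x : R) : R := expR (a * x - a ^+ 2 / 2).

Lemma shift_density_ge0 a x : (0 <= shift_density a x)%R.
Proof. exact: expR_ge0. Qed.

Lemma measurable_shift_density a : measurable_fun setT (shift_density a).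
Proof. by apply: measurableT_comp => //; apply: measurable_funD. Qed.

Lemma integral_shift_density (a : R) :
  \int[normal_prob 0 1]_x (shift_density a x)%:E = 1.
Proof.
transitivity (\int[normal_prob 0 1]_x (cst 1 x * (shift_density a x)%:E)).
  by apply: eq_integral => x _; rewrite mul1e.
by rewrite -ge0_integral_normal_shift// integral_cst//= probability_setT mule1.
Qed.

Definition vec_density d (a : 'rV[R]_d) (x : vec d) : R :=
  (\prod_(k < d) shift_density (a 0 k) (tnth x k))%R.

Lemma vec_density_ge0 d (a : 'rV[R]_d) x : (0 <= vec_density a x)%R.
Proof. by apply: prodr_ge0 => k _; exact: shift_density_ge0. Qed.

Lemma measurable_vec_density d (a : 'rV[R]_d) :
  measurable_fun setT (vec_density a).
Proof.
apply: (@measurable_tnth_prod _ (measurableTypeR R) R d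
  (fun k => shift_density (a 0%R k))) => k.
exact: measurable_shift_density.
Qed.

Lemma ge0_integral_gaussian_shift d (a : 'rV[R]_d) (f : vec d -> \bar R) :
  measurable_fun setT f -> (forall x, 0 <= f x) ->
  \int[gaussian d]_x f [tuple (a 0 k + tnth x k)%R | k < d] =
  \int[gaussian d]_x (f x * (vec_density a x)%:E).
Proof.
move=> mf f0.
apply: (@ge0_integral_iid_density _ (measurableTypeR R) R (normal_prob 0 1) d
  (fun k x => (a 0%R k + x)%R) (fun k => shift_density (a 0%R k))) => // k.
- exact: measurable_shift.
- exact: measurable_shift_density.
- exact: shift_density_ge0.
- exact: ge0_integral_normal_shift.
Qed.

Section law_density.
Variables (n m d : nat) (t : triplet (R := R) n m d).
Hypothesis sigma1 : forall j, sigma t j = 1%R.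

Let inlier_density (x : n.-tuple (vec d)) : R :=
  (\prod_(i < n) vec_density (theta t (sval (pistar t) i)) (tnth x i))%R.

Let all_density (y : m.-tuple (vec d)) : R :=
  (\prod_(j < m) vec_density (theta t j) (tnth y j))%R.

Definition law_density (z : sample n m d) : R :=
  ((\prod_(i < n) vec_density (theta t (sval (pistar t) i)) (tnth z.1 i)) *
   (\prod_(j < m) vec_density (theta t j) (tnth z.2 j)))%R.

Let inlier_density_ge0 x : (0 <= inlier_density x)%R.
Proof. by apply: prodr_ge0 => i _; exact: vec_density_ge0. Qed.

Let all_density_ge0 y : (0 <= all_density y)%R.
Proof. by apply: prodr_ge0 => i _; exact: vec_density_ge0. Qed.

Lemma law_density_ge0 z : (0 <= law_density z)%R.
Proof. exact: mulr_ge0 (inlier_density_ge0 z.1) (all_density_ge0 z.2). Qed.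

Let measurable_inlier_density : measurable_fun setT inlier_density.
Proof.
apply: (@measurable_tnth_prod _ (vec d) R n
  (fun i => vec_density (theta t (sval (pistar t) i)))) => i.
exact: measurable_vec_density.
Qed.

Let measurable_all_density : measurable_fun setT all_density.
Proof.
apply: (@measurable_tnth_prod _ (vec d) R m
  (fun j => vec_density (theta t j))) => j.
exact: measurable_vec_density.
Qed.

Lemma measurable_law_density : measurable_fun setT law_density.
Proof.
by apply: measurable_funM;
  [exact: (measurableT_comp measurable_inlier_density)
  |exact: (measurableT_comp measurable_all_density)].
Qed.

Lemma ge0_integral_noisy j (f : vec d -> \bar R) :
  measurable_fun setT f -> (forall x, 0 <= f x) ->
  \int[gaussian d]_x f (noisy t j x) =
  \int[gaussian d]_x (f x * (vec_density (theta t j) x)%:E).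
Proof.
move=> mf f0; rewrite -ge0_integral_gaussian_shift//.
apply: eq_integral => x _; congr f; apply/eq_from_tnth => k.
by rewrite !tnth_mktuple sigma1 mul1r.
Qed.

(** The pure noise law serves as a dominating measure common to all signs and matchings. Tonelli
    separates the two samples, and each is shifted coordinate by coordinate. *)
Lemma lawE (A : set (sample n m d)) : measurable A ->
  law t A = \int[noise n m d]_(z in A) (law_density z)%:E.
Proof.
move=> mA.
have mI : measurable_fun setT (fun z : sample n m d => (\1_A z : R)%:E).
  exact/measurable_EFinP.
have I0 z : 0 <= (\1_A z : R)%:E by rewrite lee_fin.
rewrite integral_mkcond /=.
transitivity (\int[noise n m d]_z ((\1_A z)%:E * (law_density z)%:E)); last first.
  apply: eq_integral => z _; rewrite patchE indicE.
  by case: ifP => _; rewrite ?mul1e ?mul0e.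
transitivity (\int[noise n m d]_z (\1_A (observe t z))%:E).
  rewrite (_ : (fun z => _) = EFin \o \1_(observe t @^-1` A))//.
  rewrite integral_indic ?setIT//.
  by rewrite -[X in measurable X]setTI; exact: measurable_observe.
have mID : measurable_fun setT
    (fun z : sample n m d => (\1_A z)%:E * (all_density z.2)%:E).
  apply: emeasurable_funM => //; apply/measurable_EFinP.
  exact: (measurableT_comp measurable_all_density).
rewrite (fubini_tonelli1 (fun z => (\1_A (observe t z))%:E))//=; last first.
  by apply: (measurableT_comp mI); exact: measurable_observe.
rewrite (fubini_tonelli1 (fun z => (\1_A z)%:E * (law_density z)%:E))//=; first last.
- by move=> z; rewrite mule_ge0// lee_fin law_density_ge0.
- apply: emeasurable_funM => //; apply/measurable_EFinP.
  exact: measurable_law_density.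
rewrite /fubini_F.
(* The inner integral once the second sample has been shifted; it becomes the integrand when the
   first sample is shifted. *)
pose G x := \int[iid (gaussian d) m]_y ((\1_A (x, y))%:E * (all_density y)%:E).
pose noisy1 (x : n.-tuple (vec d)) :=
  [tuple noisy t (sval (pistar t) i) (tnth x i) | i < n].
transitivity (\int[iid (gaussian d) n]_x G (noisy1 x)).
  apply: eq_integral => x _.
  rewrite /G.
  rewrite -(@ge0_integral_iid_density _ _ _ _ m (noisy t)
    (fun j => vec_density (theta t j)) _ _ _ _
    (fun y => (\1_A (noisy1 x, y))%:E))//.
  - exact: measurable_noisy.
  - by move=> j; exact: measurable_vec_density.
  - by move=> j y; exact: vec_density_ge0.
  - exact: ge0_integral_noisy.
  - exact: (measurableT_comp mI).
rewrite (@ge0_integral_iid_density _ _ _ _ n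
  (fun i => noisy t (sval (pistar t) i))
  (fun i => vec_density (theta t (sval (pistar t) i))) _ _ _ _ G)//.
- apply: eq_integral => x _; rewrite /G -ge0_integralZr//.
  + apply: eq_integral => y _; rewrite -muleA; congr (_ * _).
    by rewrite -EFinM mulrC.
  + by apply: (measurableT_comp mID); exact: measurable_pair1.
  + by move=> y _; rewrite mule_ge0// lee_fin; exact: all_density_ge0.
  + by rewrite lee_fin; exact: inlier_density_ge0.
- by move=> i; exact: measurable_noisy.
- by move=> i; exact: measurable_vec_density.
- by move=> i y; exact: vec_density_ge0.
- by move=> i; exact: ge0_integral_noisy.
- apply: (measurable_fun_fubini_tonelli_F
    (fun z => (\1_A z)%:E * (all_density z.2)%:E)) => //.
  by move=> z; rewrite mule_ge0// lee_fin; exact: all_density_ge0.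
- move=> x; apply: integral_ge0 => y _; rewrite mule_ge0// lee_fin.
  exact: all_density_ge0.
Qed.

End law_density.
End gaussian_vectors.

(** * The two-point mixture *)

Section second_moment.
Context {R : realType}.
Variable tau : R.

Definition sgn (b : bool) : R := (-1) ^+ b.

(** The half-sum of [shift_density tau] and [shift_density (- tau)], that is
    [cosh (tau * x) * exp (- tau ^ 2 / 2)]. *)
Definition mix (x : R) : R :=
  (expR (tau * x) + expR (- (tau * x))) / 2 * expR (- (tau ^+ 2 / 2)).

(** This is [tanh (tau * x)]; with it a sign enters the density only through the factor
    [1 + sgn b * th x]. *)
Definition th (x : R) : R :=
  (expR (tau * x) - expR (- (tau * x))) / (expR (tau * x) + expR (- (tau * x))).

Lemma mix_ge0 x : 0 <= mix x.
Proof. by rewrite mulr_ge0 ?divr_ge0 ?addr_ge0 ?expR_ge0. Qed.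

Lemma measurable_expRM (c : R) : measurable_fun setT (fun x : R => expR (c * x)).
Proof. exact: measurableT_comp. Qed.

Lemma measurable_mix : measurable_fun setT mix.
Proof.
do 2 apply: measurable_funM => //; apply: measurable_funD.
  exact: measurable_expRM.
by under eq_fun do rewrite -mulNr; exact: measurable_expRM.
Qed.

Lemma measurable_th : measurable_fun setT th.
Proof.
have mE' : measurable_fun setT (fun x : R => expR (- (tau * x))).
  by under eq_fun do rewrite -mulNr; exact: measurable_expRM.
(* The reciprocal is written as the exponential of a negated logarithm, a composition of measurable
   functions. *)
rewrite (_ : th = fun x => (expR (tau * x) - expR (- (tau * x))) *
    expR (- ln (expR (tau * x) + expR (- (tau * x))))); last first.
  apply/funext => x; congr (_ * _); rewrite [RHS]expRN lnK// posrE.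
  by rewrite addr_gt0// expR_gt0.
apply: measurable_funM.
  by apply: measurable_funB => //; exact: measurable_expRM.
apply: measurableT_comp => //; apply: measurableT_comp => //.
apply: measurableT_comp => //.
by apply: measurable_funD => //; exact: measurable_expRM.
Qed.

Lemma shift_density_sgn b x :
  shift_density (sgn b * tau) x = mix x * (1 + sgn b * th x).
Proof.
rewrite /shift_density /mix /th /sgn expRD exprMn sqrr_sign mul1r.
have := expR_gt0 (tau * x); have := expR_gt0 (- (tau * x)).
case: b; rewrite ?expr1 ?expr0 ?mulN1r ?mul1r ?mulNr.
all: set e := expR (tau * x); set e' := expR (- _); set g := expR _ => e0 e'0.
all: field; lra.
Qed.

(** With [c = cosh (tau * x)] one has [th x ^ 2 = 1 - 1 / c ^ 2]. After division by
    [exp (- tau ^ 2 / 2)] the claim is [(c + 1 / c) / 2 >= 1], where the difference is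
    [(c - 1) ^ 2 / (2 * c)]. *)
Lemma mix_th_ge x :
  expR (- (tau ^+ 2 / 2)) <= mix x * (1 - th x ^+ 2 / 2).
Proof.
rewrite /mix /th; set g := expR (- (_ / _)).
have ee' : expR (tau * x) * expR (- (tau * x)) = 1 by rewrite -expRD subrr expR0.
have := expR_gt0 (tau * x); have := expR_gt0 (- (tau * x)).
move: ee'; set e := expR (tau * x); set e' := expR (- _) => ee' e'0 e0.
have g0 : 0 < g by exact: expR_gt0.
rewrite -subr_ge0 (_ : _ - g = g * ((e + e' - 2) ^+ 2 / (4 * (e + e')))).
  by rewrite mulr_ge0 ?(ltW g0)// divr_ge0 ?sqr_ge0// mulr_ge0// addr_ge0// ltW.
have -> : e' = e^-1 by apply/(mulfI (lt0r_neq0 e0)); rewrite ee' divff ?gt_eqF.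
field; rewrite gt_eqF//=.
by rewrite gt_eqF// addr_gt0// mulr_gt0.
Qed.

(** Under the density [mix], [th] has mean zero and second moment at most [tau ^ 2]. Both facts are
    packaged for a nonnegative quadratic polynomial, so that only nonnegative functions are
    integrated. *)
Lemma le_integral_mix (u v : R) :
  0 <= v -> (forall t : R, 0 <= 1 + u * t + v * t ^+ 2) ->
  (\int[normal_prob 0 1]_x (mix x * (1 + u * th x + v * th x ^+ 2))%:E <=
   (1 + v * tau ^+ 2)%:E)%E.
Proof.
move=> v0 uv0.
pose g := expR (- (tau ^+ 2 / 2)).
have g0 : 0 <= g by exact: expR_ge0.
pose h x := mix x * (1 + u * th x + v * th x ^+ 2).
have h0 x : 0 <= h x by rewrite mulr_ge0 ?mix_ge0.
have mh : measurable_fun setT h.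
  apply: measurable_funM; first exact: measurable_mix.
  apply: measurable_funD; first apply: measurable_funD => //.
    by apply: measurable_funM => //; exact: measurable_th.
  by apply: measurable_funM => //; apply: measurable_funX; exact: measurable_th.
(* Chosen so that [a + b = 1 + 2 * v] and [a - b = u]; then [H x] below equals
   [mix x * (1 + 2 * v + u * th x)]. Nonnegativity comes from [v0] and from [uv0] at [1] and
   [-1]. *)
pose a := (1 + u) / 2 + v; pose b := (1 - u) / 2 + v.
have a0 : 0 <= a by have := uv0 1; rewrite /a; lra.
have b0 : 0 <= b by have := uv0 (-1); rewrite /b; lra.
(* sinh^2 / cosh <= 2 * (cosh - 1); the negative constant is moved to the left
   so that both sides are nonnegative. *)
pose H x := a * shift_density tau x + b * shift_density (- tau) x.
have hH x : h x + 2 * g * v <= H x.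
  have := shift_density_sgn false x; have := shift_density_sgn true x.
  rewrite /sgn expr0 expr1 mulN1r !mul1r /H => -> ->.
  have := mix_th_ge x; rewrite -/g -subr_ge0 => /(mulr_ge0 v0).
  move=> /(mulr_ge0 (ler0n R 2)) P; rewrite -subr_ge0; move: P.
  by congr (_ <= _); rewrite /h /a /b; field.
have c0 : 0 <= 2 * g * v by rewrite !mulr_ge0.
have : (\int[normal_prob 0 1]_x (h x)%:E + (2 * g * v)%:E <= (1 + 2 * v)%:E)%E.
  have -> : ((2 * g * v)%:E = \int[normal_prob (0 : R) 1]_x (cst (2 * g * v)%:E) x)%E.
    by rewrite integral_cst//= probability_setT mule1.
  rewrite -ge0_integralD//; first last.
  - exact/measurable_EFinP.
  - by move=> x _; rewrite lee_fin.
  apply: (@le_trans _ _ (\int[normal_prob 0 1]_x (H x)%:E)%E).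
    apply: ge0_le_integral => //.
    - by move=> x _; rewrite -EFinD lee_fin addr_ge0.
    - by apply/measurable_EFinP; exact: measurable_funD.
    - apply/measurable_EFinP; apply: measurable_funD; apply: measurable_funM => //;
        exact: measurable_shift_density.
    - by move=> x _; rewrite -EFinD lee_fin.
  have int_scale (k c : R) : 0 <= k ->
      (\int[normal_prob 0 1]_x (k * shift_density c x)%:E = k%:E)%E.
    move=> k0; under eq_integral do rewrite EFinM.
    rewrite ge0_integralZl_EFin//; last 2 first.
    - by move=> x _; rewrite lee_fin shift_density_ge0.
    - by apply/measurable_EFinP; exact: measurable_shift_density.
    by rewrite integral_shift_density mule1.
  under eq_integral do rewrite EFinD.
  rewrite ge0_integralD//.
  - by rewrite !int_scale// -EFinD lee_fin /a /b; lra.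
  - by move=> x _; rewrite lee_fin mulr_ge0 ?shift_density_ge0.
  - apply/measurable_EFinP; apply: measurable_funM => //.
    exact: measurable_shift_density.
  - by move=> x _; rewrite lee_fin mulr_ge0 ?shift_density_ge0.
  - apply/measurable_EFinP; apply: measurable_funM => //.
    exact: measurable_shift_density.
rewrite -leeBrDr// => /le_trans; apply.
rewrite -EFinB lee_fin.
(* It remains to see that [2 * v * (1 - g) <= v * tau ^ 2]. *)
have : 1 - tau ^+ 2 / 2 <= g by have := expR_ge1Dx (- (tau ^+ 2 / 2)).
nra.
Qed.

End second_moment.

(** * Likelihood ratio of the random signs and its second moment *)

Lemma injective_fiber (I J : finType) (f : I -> J) (j : J) : injective f ->
  (forall i, (f i == j) = false) \/ exists i0, forall i, (f i == j) = (i == i0).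
Proof.
move=> finj; case: (pickP (fun i => f i == j)) => [i0 /eqP <-|]; last by left.
by right; exists i0 => i; rewrite (inj_eq finj).
Qed.

Section sign_prior.
Context {R : realType} {n m d : nat}.
Variable tau : R.

Local Notation mix := (mix tau).
Local Notation th := (th tau).

Lemma le_integral_gaussian_prod p (f : 'I_p -> 'I_d -> R -> R)
    (c : 'I_p -> 'I_d -> R) :
  (forall i k, measurable_fun setT (f i k)) -> (forall i k x, 0 <= f i k x) ->
  (forall i k, (\int[normal_prob 0 1]_x (f i k x)%:E <= (c i k)%:E)%E) ->
  (\int[iid (gaussian d) p]_x
     (\prod_(i < p) \prod_(k < d) f i k (tnth (tnth x i) k))%:E <=
   (\prod_(i < p) \prod_(k < d) c i k)%:E)%E.
Proof.
move=> mf f0 fc.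
apply: (@le_integral_iid_prod _ (vec d) R (gaussian d) p
  (fun i (x : vec d) => \prod_(k < d) f i k (tnth x k))) => i.
- by apply: (@measurable_tnth_prod _ (measurableTypeR R) R d (f i)) => k; exact: mf.
- move=> x; apply: prodr_ge0 => k _; exact: f0.
- by apply: (@le_integral_iid_prod _ (measurableTypeR R) R (normal_prob 0 1) d
    (f i) (c i)) => k; [exact: mf|exact: f0|exact: fc].
Qed.

Lemma measurable_gaussian_prod p (f : 'I_p -> 'I_d -> R -> R) :
  (forall i k, measurable_fun setT (f i k)) ->
  measurable_fun setT (fun x : p.-tuple (vec d) =>
     \prod_(i < p) \prod_(k < d) f i k (tnth (tnth x i) k)).
Proof.
move=> mf.
apply: (@measurable_tnth_prod _ (vec d) R p
  (fun i (x : vec d) => \prod_(k < d) f i k (tnth x k))) => i.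
by apply: (@measurable_tnth_prod _ (measurableTypeR R) R d (f i)) => k; exact: mf.
Qed.

Definition mixture (z : sample n m d) : R :=
  (\prod_(i < n) \prod_(k < d) mix (tnth (tnth z.1 i) k)) *
  (\prod_(j < m) \prod_(k < d) mix (tnth (tnth z.2 j) k)).

(** For an injective matching [f], the likelihood ratio with respect to [mixture] after averaging
    over uniform signs: matched coordinates share their sign. *)
Definition correlation (f : 'I_n -> 'I_m) (z : sample n m d) : R :=
  \prod_(i < n) \prod_(k < d)
    (1 + th (tnth (tnth z.1 i) k) * th (tnth (tnth z.2 (f i)) k)).

Lemma mixture_ge0 z : 0 <= mixture z.
Proof.
by rewrite mulr_ge0// !prodr_ge0// => *; rewrite prodr_ge0// => *; exact: mix_ge0.
Qed.

Lemma measurable_mixture : measurable_fun setT mixture.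
Proof.
apply: measurable_funM.
  apply: (measurableT_comp (f := fun x : n.-tuple (vec d) =>
    \prod_(i < n) \prod_(k < d) mix (tnth (tnth x i) k))) => //.
  by apply: (@measurable_gaussian_prod n (fun _ _ => mix)) => *; exact: measurable_mix.
apply: (measurableT_comp (f := fun x : m.-tuple (vec d) =>
  \prod_(i < m) \prod_(k < d) mix (tnth (tnth x i) k))) => //.
by apply: (@measurable_gaussian_prod m (fun _ _ => mix)) => *; exact: measurable_mix.
Qed.

Lemma measurable_th_sample1 i k :
  measurable_fun setT (fun z : sample n m d => th (tnth (tnth z.1 i) k)).
Proof.
apply: (measurableT_comp (measurable_th tau)).
apply: (measurableT_comp (f := fun x : vec d => tnth x k)).
  exact: measurable_tnth.
apply: (measurableT_comp (f := fun x : n.-tuple (vec d) => tnth x i)) => //.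
exact: measurable_tnth.
Qed.

Lemma measurable_th_sample2 j k :
  measurable_fun setT (fun z : sample n m d => th (tnth (tnth z.2 j) k)).
Proof.
apply: (measurableT_comp (measurable_th tau)).
apply: (measurableT_comp (f := fun x : vec d => tnth x k)).
  exact: measurable_tnth.
apply: (measurableT_comp (f := fun x : m.-tuple (vec d) => tnth x j)) => //.
exact: measurable_tnth.
Qed.

Lemma measurable_correlation f : measurable_fun setT (correlation f).
Proof.
apply: (@measurable_prod _ (sample n m d) R setT _ (index_enum _)
  (fun i z => \prod_(k < d)
    (1 + th (tnth (tnth z.1 i) k) * th (tnth (tnth z.2 (f i)) k)))) => i _.
apply: (@measurable_prod _ (sample n m d) R setT _ (index_enum _)
  (fun k z => (1 + th (tnth (tnth z.1 i) k) * th (tnth (tnth z.2 (f i)) k)))) => k _.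
apply: measurable_funD => //; apply: measurable_funM.
  exact: measurable_th_sample1.
exact: measurable_th_sample2.
Qed.

(** Integrates out one coordinate of the second sample; [s] stands for the value of [th] at the
    coordinate of the first sample matched with it. *)
Lemma le_integral_mix_square (s : R) :
  (\int[normal_prob 0 1]_x (mix x * (1 + s * th x) ^+ 2)%:E <=
   (1 + tau ^+ 2 * s ^+ 2)%:E)%E.
Proof.
have E x : mix x * (1 + 2 * s * th x + s ^+ 2 * th x ^+ 2) =
    mix x * (1 + s * th x) ^+ 2 by ring.
have := @le_integral_mix R tau (2 * s) (s ^+ 2) (sqr_ge0 _).
rewrite [tau ^+ 2 * _]mulrC; under eq_integral do rewrite E.
by apply => t; rewrite (_ : _ + _ = (1 + s * t) ^+ 2) ?sqr_ge0//; ring.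
Qed.

Lemma le_integral_mix1 : (\int[normal_prob 0 1]_x (mix x)%:E <= 1)%E.
Proof.
have := le_integral_mix_square 0.
by rewrite expr0n mulr0 addr0; under eq_integral do
  rewrite mul0r addr0 expr1n mulr1.
Qed.

(** The factor [1 + tau ^ 2 * s ^ 2] left by the second sample is integrated over the first; each
    integration contributes one [tau ^ 2]. *)
Lemma le_integral_mix_th_sqr :
  (\int[normal_prob 0 1]_x (mix x * (1 + tau ^+ 2 * th x ^+ 2))%:E <=
   (1 + tau ^+ 4)%:E)%E.
Proof.
have := @le_integral_mix R tau 0 (tau ^+ 2) (sqr_ge0 _).
rewrite -exprD; under eq_integral do rewrite mul0r addr0.
by apply => t; rewrite mul0r addr0 addr_ge0// mulr_ge0 ?sqr_ge0.
Qed.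

Lemma le_integral_mixture : (\int[noise n m d]_z (mixture z)%:E <= 1)%E.
Proof.
rewrite (fubini_tonelli1 (fun z => (mixture z)%:E))//=; last 2 first.
- by apply/measurable_EFinP; exact: measurable_mixture.
- by move=> z; rewrite lee_fin mixture_ge0.
rewrite /fubini_F.
pose A p (x : p.-tuple (vec d)) := \prod_(i < p) \prod_(k < d) mix (tnth (tnth x i) k).
have A0 p x : 0 <= A p x.
  by apply: prodr_ge0 => i _; apply: prodr_ge0 => k _; exact: mix_ge0.
have mA p : measurable_fun setT (A p).
  by apply: (@measurable_gaussian_prod p (fun _ _ => mix)) => *; exact: measurable_mix.
have A1 p : (\int[iid (gaussian d) p]_x (A p x)%:E <= 1)%E.
  have := @le_integral_gaussian_prod p (fun _ _ => mix) (fun _ _ => 1)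
    (fun _ _ => measurable_mix tau) (fun _ _ => mix_ge0 tau)
    (fun _ _ => le_integral_mix1).
  by rewrite big1// => i _; rewrite big1.
apply: le_trans (A1 n); apply: ge0_le_integral => //.
- by move=> x _; apply: integral_ge0 => y _; rewrite lee_fin mixture_ge0.
- apply: (measurable_fun_fubini_tonelli_F (fun z => (mixture z)%:E)) => //.
    by apply/measurable_EFinP; exact: measurable_mixture.
  by move=> z; rewrite lee_fin mixture_ge0.
- by apply/measurable_EFinP; exact: mA.
move=> x _; rewrite /mixture /= -/(A n x).
under eq_integral do rewrite EFinM.
rewrite ge0_integralZl_EFin//.
- by rewrite -[leRHS]mule1 lee_wpmul2l ?lee_fin//; exact: A1.
- by move=> y _; rewrite lee_fin; exact: A0.
- by apply/measurable_EFinP; exact: mA.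
Qed.

(* Conditionally on [z.1], every coordinate of [z.2] is correlated with at most
   one coordinate of [z.1], because [f] is injective. *)
Lemma le_integral_correlation (f : 'I_n -> 'I_m) : injective f ->
  (\int[noise n m d]_z (mixture z * correlation f z ^+ 2)%:E <=
   ((1 + tau ^+ 4) ^+ (n * d))%:E)%E.
Proof.
move=> finj.
pose A (x : n.-tuple (vec d)) := \prod_(i < n) \prod_(k < d) mix (tnth (tnth x i) k).
pose B (x : n.-tuple (vec d)) :=
  \prod_(i < n) \prod_(k < d) (1 + tau ^+ 2 * th (tnth (tnth x i) k) ^+ 2).
have A0 x : 0 <= A x.
  by apply: prodr_ge0 => i _; apply: prodr_ge0 => k _; exact: mix_ge0.
rewrite (fubini_tonelli1 (fun z => (mixture z * correlation f z ^+ 2)%:E))//=;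
  last 2 first.
- apply/measurable_EFinP; apply: measurable_funM; first exact: measurable_mixture.
  by apply: measurable_funX; exact: measurable_correlation.
- by move=> z; rewrite lee_fin mulr_ge0 ?mixture_ge0 ?sqr_ge0.
rewrite /fubini_F.
(* [G x j k] gathers the factors that depend on coordinate [k] of vector [j] of the second
   sample. *)
pose G (x : n.-tuple (vec d)) j k (y : R) :=
  mix y * \prod_(i < n | f i == j) (1 + th (tnth (tnth x i) k) * th y) ^+ 2.
have inner x : (\int[iid (gaussian d) m]_y
      (mixture (x, y) * correlation f (x, y) ^+ 2)%:E <=
    (A x * B x)%:E)%E.
  have GE y : mixture (x, y) * correlation f (x, y) ^+ 2 =
      A x * \prod_(j < m) \prod_(k < d) G x j k (tnth (tnth y j) k).
    rewrite /mixture /= -/(A x) -mulrA; congr (_ * _).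
    rewrite /G; under [in RHS]eq_bigr do rewrite big_split.
    rewrite big_split; congr (_ * _).
    rewrite /correlation -prodrXl (partition_big f xpredT)//=.
    apply: eq_bigr => j _; rewrite exchange_big/=; apply: eq_bigr => i /eqP <-.
    by rewrite -prodrXl.
  under eq_integral do rewrite GE EFinM.
  have mG j k : measurable_fun setT (G x j k).
    apply: measurable_funM; first exact: measurable_mix.
    under eq_fun do rewrite -big_filter.
    apply: (@measurable_prod _ R R setT _ [seq i <- index_enum 'I_n | f i == j]
      (fun i y => (1 + th (tnth (tnth x i) k) * th y) ^+ 2)) => i _.
    apply: measurable_funX; apply: measurable_funD => //.
    by apply: measurable_funM => //; exact: measurable_th.
  have G0 j k y : 0 <= G x j k y.
    by rewrite mulr_ge0 ?mix_ge0// prodr_ge0// => i _; exact: sqr_ge0.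
  rewrite ge0_integralZl_EFin//; first last.
  - by apply/measurable_EFinP; exact: measurable_gaussian_prod.
  - by move=> y _; rewrite lee_fin; apply: prodr_ge0 => j _; apply: prodr_ge0.
  rewrite EFinM lee_wpmul2l ?lee_fin//.
  rewrite (_ : B x = \prod_(j < m) \prod_(k < d) \prod_(i < n | f i == j)
      (1 + tau ^+ 2 * th (tnth (tnth x i) k) ^+ 2)); last first.
    rewrite /B (partition_big f xpredT)//=.
    by apply: eq_bigr => j _; rewrite exchange_big.
  apply: le_integral_gaussian_prod => // j k; rewrite /G.
  (* An unmatched [j] leaves only [mix], of mass at most 1; a matched one leaves a single square. *)
  have [fj|[i0 fj]] := injective_fiber j finj.
    under eq_integral do rewrite big_pred0// mulr1.
    by rewrite big_pred0//; exact: le_integral_mix1.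
  under eq_integral do rewrite (big_pred1 i0)//.
  by rewrite (big_pred1 i0)//; exact: le_integral_mix_square.
apply: (@le_trans _ _ (\int[iid (gaussian d) n]_x (A x * B x)%:E)%E).
  apply: ge0_le_integral => //.
  - move=> x _; apply: integral_ge0 => y _.
    by rewrite lee_fin mulr_ge0 ?mixture_ge0 ?sqr_ge0.
  - apply: (measurable_fun_fubini_tonelli_F
      (fun z => (mixture z * correlation f z ^+ 2)%:E)).
      apply/measurable_EFinP; apply: measurable_funM; first exact: measurable_mixture.
      by apply: measurable_funX; exact: measurable_correlation.
    by move=> z; rewrite lee_fin mulr_ge0 ?mixture_ge0 ?sqr_ge0.
  - apply/measurable_EFinP; apply: measurable_funM.
      apply: (@measurable_gaussian_prod n (fun _ _ => mix)) => *.
      exact: measurable_mix.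
    apply: (@measurable_gaussian_prod n (fun _ _ y => 1 + tau ^+ 2 * th y ^+ 2)) => i k.
    apply: measurable_funD => //; apply: measurable_funM => //.
    by apply: measurable_funX; exact: measurable_th.
have -> : (1 + tau ^+ 4) ^+ (n * d) = \prod_(i < n) \prod_(k < d) (1 + tau ^+ 4).
  by rewrite !prodr_const !card_ord -exprM mulnC.
have ABE x : A x * B x = \prod_(i < n) \prod_(k < d)
    (fun y => mix y * (1 + tau ^+ 2 * th y ^+ 2)) (tnth (tnth x i) k).
  by rewrite /A /B -big_split; apply: eq_bigr => i _; rewrite -big_split.
under eq_integral do rewrite ABE.
apply: (@le_integral_gaussian_prod n
  (fun _ _ y => mix y * (1 + tau ^+ 2 * th y ^+ 2)) (fun _ _ => 1 + tau ^+ 4))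
  => [i k|i k y|i k].
- apply: measurable_funM; first exact: measurable_mix.
  apply: measurable_funD => //; apply: measurable_funM => //.
  by apply: measurable_funX; exact: measurable_th.
- by rewrite mulr_ge0 ?mix_ge0// addr_ge0// mulr_ge0 ?sqr_ge0.
- exact: le_integral_mix_th_sqr.
Qed.

End sign_prior.

(** * The Bayes risk under random signs *)

Section bayes_risk.
Context {R : realType} {n m d : nat}.
Variable tau : R.

Implicit Types (eps : {ffun 'I_m * 'I_d -> bool}) (p : injection n m).

(** The noise levels are inferred from [ltr01]: all are equal to 1. *)
Definition sign_triplet eps p : triplet (R := R) n m d :=
  Triplet (fun j => \row_(k < d) (sgn (eps (j, k)) * tau)) (fun=> ltr01) p.

Lemma injection_inj p : injective (sval p).
Proof. exact/injectiveP/(valP p). Qed.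

(** The sum over sign patterns factors over the entries [(j, k)]. A matched entry contributes [(1 +
    s) * (1 + t) + (1 - s) * (1 - t) = 2 * (1 + s * t)], an unmatched one contributes [2]. *)
Lemma sum_sign_law_density p (z : sample n m d) :
  \sum_eps law_density (sign_triplet eps p) z =
  2 ^+ (m * d) * (mixture tau z * correlation tau (sval p) z).
Proof.
pose x i k := tnth (tnth z.1 i) k; pose y j k := tnth (tnth z.2 j) k.
pose F (jk : 'I_m * 'I_d) (b : bool) := (1 + sgn b * th tau (y jk.1 jk.2)) *
  \prod_(i < n | sval p i == jk.1) (1 + sgn b * th tau (x i jk.2)).
have E eps : law_density (sign_triplet eps p) z =
    mixture tau z * \prod_(jk : 'I_m * 'I_d) F jk (eps jk).
  rewrite (eq_bigr (fun jk => F jk (eps (jk.1, jk.2)))); last first.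
    by move=> [j k] _.
  rewrite /law_density /mixture /vec_density /=.
  under eq_bigr do under eq_bigr do rewrite mxE shift_density_sgn.
  under eq_bigr do rewrite big_split.
  rewrite big_split /=.
  under [X in _ * X = _]eq_bigr do under eq_bigr do rewrite mxE shift_density_sgn.
  under [X in _ * X = _]eq_bigr do rewrite big_split.
  rewrite [X in _ * X = _]big_split /= mulrACA; congr (_ * _).
  rewrite [RHS]big_split /= mulrC; congr (_ * _); first by rewrite pair_bigA.
  rewrite (partition_big (sval p) xpredT)//=.
  rewrite -(pair_bigA _ (fun j k => \prod_(i < n | sval p i == j)
    (1 + sgn (eps (j, k)) * th tau (x i k)))) /=.
  apply: eq_bigr => j _; rewrite exchange_big/=; apply: eq_bigr => k _.
  by apply: eq_bigr => i /eqP <-.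
under eq_bigr do rewrite E.
rewrite -big_distrr /= -(bigA_distr_bigA F) mulrCA; congr (_ * _).
have S jk : \sum_b F jk b = 2 * \prod_(i < n | sval p i == jk.1)
    (1 + th tau (x i jk.2) * th tau (y jk.1 jk.2)).
  rewrite big_bool /F /sgn /= expr0 expr1.
  have [fj|[i0 fj]] := injective_fiber jk.1 (@injection_inj p).
    by rewrite !big_pred0//; ring.
  by rewrite !(big_pred1 i0)//; ring.
under eq_bigr do rewrite S.
rewrite big_split /= prodr_const card_prod !card_ord; congr (_ * _).
rewrite -(pair_bigA _ (fun j k => \prod_(i < n | sval p i == j)
    (1 + th tau (x i k) * th tau (y j k)))) /=.
rewrite /correlation (partition_big (sval p) xpredT)//=.
apply: eq_bigr => j _; rewrite exchange_big/=; apply: eq_bigr => i /eqP <-.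
by [].
Qed.

(** Unnormalized form: division by [2 ^ (m * d) * m ^_ n], the number of pairs of a sign pattern and
    an injection, gives the Bayes success probability. *)
Lemma le_sum_law_success (pihat : sample n m d -> injection n m) :
  is_estimator pihat -> (n <= m)%N ->
  (\sum_(p : injection n m) \sum_eps law (sign_triplet eps p) [set z | pihat z = p] <=
   (2 ^+ (m * d) * ((m ^_ n)%:R / 4 + (1 + tau ^+ 4) ^+ (n * d)))%:E)%E.
Proof.
move=> estim nm; set N : R := (m ^_ n)%:R.
have N0 : 0 < N by rewrite ltr0n ffact_gt0.
have mA p : measurable [set z | pihat z = p] by exact: (estim [set p]).
have mD p eps : measurable_fun setT
    (fun z => (law_density (sign_triplet eps p) z * \1_[set z | pihat z = p] z)%:E).
  apply/measurable_EFinP; apply: measurable_funM => //.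
  exact: measurable_law_density.
have D0 p eps z :
    (0 <= (law_density (sign_triplet eps p) z * \1_[set z | pihat z = p] z)%:E)%E.
  by rewrite lee_fin mulr_ge0// law_density_ge0.
have lawI p eps : law (sign_triplet eps p) [set z | pihat z = p] =
    (\int[noise n m d]_z (law_density (sign_triplet eps p) z *
      \1_[set z | pihat z = p] z)%:E)%E.
  rewrite lawE// integral_mkcond; apply: eq_integral => z _.
  by rewrite patchE indicE; case: ifP => _; rewrite ?mulr1 ?mulr0.
under eq_bigr do under eq_bigr do rewrite lawI.
under eq_bigr do rewrite -ge0_integral_sum//.
rewrite -ge0_integral_sum//; last 2 first.
- by move=> p; exact: emeasurable_sum.
- by move=> p z _; apply: sume_ge0.
(* The coefficients of [K <= N / 4 + K ^ 2 / N], times the number of sign patterns. *)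
pose c1 : R := 2 ^+ (m * d) * (N / 4); pose c2 : R := 2 ^+ (m * d) / N.
have c10 : 0 <= c1 by rewrite mulr_ge0 ?divr_ge0 ?ltW.
have c20 : 0 <= c2 by rewrite divr_ge0 ?ltW.
pose S (z : sample n m d) : R :=
  \sum_(p : injection n m) mixture tau z * correlation tau (sval p) z ^+ 2.
have mp p : measurable_fun setT
    (fun z : sample n m d => mixture tau z * correlation tau (sval p) z ^+ 2).
  apply: measurable_funM; first exact: measurable_mixture.
  by apply: measurable_funX; exact: measurable_correlation.
have p0 p (z : sample n m d) : 0 <= mixture tau z * correlation tau (sval p) z ^+ 2.
  by rewrite mulr_ge0 ?mixture_ge0 ?sqr_ge0.
have mS : measurable_fun setT S by exact: measurable_sum.
have S0 z : 0 <= S z by rewrite sumr_ge0.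
apply: (@le_trans _ _ (\int[noise n m d]_z
    (c1%:E * (mixture tau z)%:E + c2%:E * (S z)%:E))%E).
  apply: ge0_le_integral => //.
  - by move=> z _; apply: sume_ge0 => p _; apply: sume_ge0.
  - by apply: emeasurable_sum => p; exact: emeasurable_sum.
  - apply: emeasurable_funD; apply: emeasurable_funM => //;
      apply/measurable_EFinP => //.
    exact: measurable_mixture.
  move=> z _; rewrite -!EFinM -EFinD.
  under eq_bigr do rewrite sumEFin -mulr_suml sum_sign_law_density.
  rewrite sumEFin lee_fin.
  (* At each [z] only the injection [pihat z] contributes. *)
  rewrite (bigD1 (pihat z))//= big1 ?addr0; last first.
    by move=> p /eqP pz; rewrite indicE memNset ?mulr0// => /= /esym.
  rewrite indicE mem_set// mulr1.
  apply: (@le_trans _ _ (c1 * mixture tau z + c2 *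
      (mixture tau z * correlation tau (sval (pihat z)) z ^+ 2))).
    rewrite -subr_ge0 /c1 /c2.
    (* The square comes from [N / 4 - K + K ^ 2 / N = (N / 2 - K) ^ 2 / N]. *)
    rewrite (_ : _ - _ = 2 ^+ (m * d) * mixture tau z *
        ((N / 2 - correlation tau (sval (pihat z)) z) ^+ 2 / N)).
      rewrite mulr_ge0 ?divr_ge0 ?sqr_ge0 ?(ltW N0)//.
      by rewrite mulr_ge0 ?exprn_ge0 ?mixture_ge0.
    by field; rewrite gt_eqF.
  (* Passing to the sum over all injections removes the dependence on the estimator. *)
  rewrite lerD2l ler_wpM2l// /S (bigD1 (pihat z))//= lerDl sumr_ge0//.
rewrite ge0_integralD//; last 4 first.
- by move=> z _; rewrite mule_ge0// lee_fin// mixture_ge0.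
- apply: emeasurable_funM => //; apply/measurable_EFinP; exact: measurable_mixture.
- by move=> z _; rewrite mule_ge0// lee_fin.
- by apply: emeasurable_funM => //; exact/measurable_EFinP.
rewrite ge0_integralZl_EFin//; last 2 first.
- by move=> z _; rewrite lee_fin mixture_ge0.
- by apply/measurable_EFinP; exact: measurable_mixture.
rewrite ge0_integralZl_EFin//; last 2 first.
- by move=> z _; rewrite lee_fin.
- exact/measurable_EFinP.
rewrite mulrDr EFinD leeD//.
  by rewrite -[leRHS]mule1 lee_wpmul2l// ?lee_fin//; exact: le_integral_mixture.
rewrite (_ : 2 ^+ (m * d) * _ = c2 * (N * (1 + tau ^+ 4) ^+ (n * d))); last first.
  by rewrite /c2 mulrA divfK// gt_eqF.
rewrite [leRHS]EFinM lee_wpmul2l ?lee_fin//.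
under eq_integral do rewrite -sumEFin.
rewrite ge0_integral_sum//; last 2 first.
- by move=> p; exact/measurable_EFinP.
- by move=> p z _; rewrite lee_fin.
apply: (@le_trans _ _ (\sum_(p : injection n m) ((1 + tau ^+ 4) ^+ (n * d))%:E)%E).
  by apply: lee_sum => p _; exact/le_integral_correlation/injection_inj.
rewrite sumEFin lee_fin sumr_const -mulr_natl.
by rewrite card_sig -cardsE card_inj_ffuns !card_ord.
Qed.

End bayes_risk.

(** * Separation of random signs *)

(** Pair the factor [m - i] with the factor of mirrored index, which is at least [i + 1]; then
    [(m - i) * (i + 1) >= m], the difference being [i * (m - i - 1)]. *)
Lemma leq_exp_ffact_sqr n m : (n <= m)%N -> (m ^ n <= (m ^_ n) ^ 2)%N.
Proof.
move=> nm.
have ffE : m ^_ n = (\prod_(i < n) (m - (n - i.+1)))%N.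
  by rewrite ffact_prod (reindex_inj rev_ord_inj).
rewrite expnS expn1 {1}ffE ffact_prod -big_split /=.
rewrite -{1}[n]card_ord -prod_nat_const; apply: leq_prod => i _.
have im := leq_trans (ltn_ord i) nm.
apply: (@leq_trans ((m - i) * i.+1)).
  rewrite -{1}(subnK (ltnW im)) -(subnSK im) mulSn mulnS; nia.
by rewrite mulnC leq_mul//=; have := ltn_ord i; lia.
Qed.

Section separated_signs.
Context {R : realType} {m d : nat}.
Implicit Types eps : {ffun 'I_m * 'I_d -> bool}.

Definition hamming eps (i j : 'I_m) : nat :=
  (\sum_(k < d) (eps (i, k) != eps (j, k)))%N.

Definition well_separated eps : bool :=
  [forall i, forall j, (i != j) ==> (d <= 8 * hamming eps i j)%N].

(** Adding row [j] to row [i] modulo 2 is an involution of the sign patterns that turns the Hamming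
    distance into the number of true entries of row [i]; the sum then factors over entries. *)
Lemma sum_expr_hamming (z : R) i j : i != j ->
  \sum_eps z ^+ hamming eps i j = 2 ^+ (m * d) * ((1 + z) / 2) ^+ d.
Proof.
move=> ij.
pose h eps : {ffun 'I_m * 'I_d -> bool} :=
  [ffun lk => if lk.1 == i then eps lk (+) eps (j, lk.2) else eps lk].
have hK : involutive h.
  move=> eps; apply/ffunP => -[l k]; rewrite !ffunE /=.
  case: eqP => // _; rewrite eq_sym (negbTE ij).
  by rewrite -addbA addbb addbF.
rewrite (reindex_inj (inv_inj hK)) /=.
pose F (lk : 'I_m * 'I_d) (b : bool) : R := if lk.1 == i then z ^+ b else 1.
transitivity (\sum_(eps : {ffun 'I_m * 'I_d -> bool}) \prod_lk F lk (eps lk)).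
  apply: eq_bigr => eps _; rewrite /hamming expr_sum.
  rewrite (eq_bigr (fun lk => F (lk.1, lk.2) (eps (lk.1, lk.2)))); last first.
    by move=> [].
  rewrite -(pair_bigA _ (fun l k => F (l, k) (eps (l, k)))) /= (bigD1 i)//=.
  rewrite [X in _ * X]big1 ?mulr1; last first.
    by move=> l li; rewrite big1// => k _; rewrite /F /= (negbTE li).
  apply: eq_bigr => k _; rewrite /F /= !ffunE /= eqxx (eq_sym j i) (negbTE ij).
  by case: (eps (i, k)); case: (eps (j, k)).
rewrite -(bigA_distr_bigA F).
have S lk : \sum_b F lk b = 2 * (if lk.1 == i then (1 + z) / 2 else 1).
  by rewrite big_bool /F; case: eqP => _ /=; rewrite ?expr0 ?expr1; field.
under eq_bigr do rewrite S.
rewrite big_split /= prodr_const card_prod !card_ord; congr (_ * _).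
rewrite -(pair_bigA _ (fun l k => if l == i then (1 + z) / 2 else 1)) /=.
rewrite (bigD1 i)//= [X in _ * X]big1 ?mulr1.
  by rewrite eqxx prodr_const card_ord.
by move=> l li; rewrite big1// (negbTE li).
Qed.

(* A Chernoff bound, with base [4 / 5]. *)
Lemma card_close_rows i j : i != j ->
  (#|[pred eps | (8 * hamming eps i j < d)%N]|)%:R <=
  2 ^+ (m * d) * (3 / 4 : R) ^+ d.
Proof.
move=> ij; pose y : R := 4 / 5.
have y0 : 0 < y by rewrite /y; lra.
have y1 : y <= 1 by rewrite /y; lra.
(* For a close pair the exponent [8 * hamming - d] of [y] is negative, so the weight is at least
   1. *)
apply: (@le_trans _ _ (\sum_eps y ^- d * (y ^+ 8) ^+ hamming eps i j)).
  rewrite -sum1_card natr_sum big_mkcond /=; apply: ler_sum => eps _.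
  rewrite inE; case: ifP => [close|_]; last first.
    by rewrite mulr_ge0 ?invr_ge0 ?exprn_ge0 ?ltW.
  rewrite -exprM mulrC ler_pdivlMr ?exprn_gt0// mul1r.
  by apply: ler_wiXn2l => //; [exact: ltW|exact: ltnW].
rewrite -mulr_sumr sum_expr_hamming// mulrCA ler_wpM2l ?exprn_ge0//.
rewrite -exprVn -exprMn lerXn2r ?nnegrE//.
- by rewrite mulr_ge0 ?invr_ge0 ?(ltW y0)// divr_ge0// addr_ge0// exprn_ge0// ltW.
(* Numerically, [5 / 4 * (1 + (4 / 5) ^ 8) / 2] is about 0.73. *)
- by rewrite /y; lra.
Qed.

Lemma card_not_separated :
  (#|[pred eps | ~~ well_separated eps]|)%:R <=
  2 ^+ (m * d) * ((m ^ 2)%:R * (3 / 4 : R) ^+ d).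
Proof.
apply: (@le_trans _ _ (\sum_(ij : 'I_m * 'I_m | ij.1 != ij.2)
    (#|[pred eps | (8 * hamming eps ij.1 ij.2 < d)%N]|)%:R)).
  rewrite -natr_sum ler_nat -sum1_card big_mkcond /=.
  under [leqRHS]eq_bigr do rewrite -sum1_card big_mkcond.
  rewrite exchange_big; apply: leq_sum => eps _; rewrite inE.
  case: ifP => //; rewrite negb_forall => /existsP[i].
  rewrite negb_forall => /existsP[j]; rewrite negb_imply -ltnNge => /andP[ij close].
  by rewrite (bigD1 (i, j))//= inE close.
apply: (@le_trans _ _ (\sum_(ij : 'I_m * 'I_m) 2 ^+ (m * d) * (3 / 4 : R) ^+ d)).
  rewrite big_mkcond; apply: ler_sum => -[i j] _.
  case: ifP => [ij|_]; first exact: card_close_rows.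
  by rewrite mulr_ge0// exprn_ge0//; lra.
rewrite sumr_const card_prod !card_ord expnS expn1.
by rewrite -[leLHS]mulr_natl mulrCA.
Qed.

End separated_signs.

(** * From Hamming distances to [kappa] *)

Section separated_triplet.
Context {R : realType} {n m d : nat}.

(** Each differing sign adds [(2 * tau) ^ 2] to the squared distance, and the two unit variances
    divide it by 2. *)
Lemma separation_sign_triplet (tau : R) (eps : {ffun 'I_m * 'I_d -> bool})
    (p : injection n m) i j :
  separation (sign_triplet tau eps p) i j =
  Num.sqrt (2 * tau ^+ 2 * (hamming eps i j)%:R).
Proof.
rewrite /separation /norm2 /= expr1n.
rewrite (_ : \sum_(k < d) _ = 2 * (2 * tau ^+ 2 * (hamming eps i j)%:R)); last first.
  rewrite /hamming natr_sum !mulr_sumr; apply: eq_bigr => k _.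
  rewrite !mxE /sgn; case: (eps (i, k)); case: (eps (j, k)) => /=;
    rewrite ?expr0 ?expr1; ring.
by rewrite sqrtrM// -[1 + 1]/(2 : R) mulrAC divff ?mul1r// gt_eqF// sqrtr_gt0.
Qed.

Lemma le_kappa (t : triplet (R := R) n m d) (c : R) :
  (forall i j, i != j -> c <= separation t i j) -> (c%:E <= kappa t)%E.
Proof.
move=> ct; rewrite /kappa le_min; apply/andP; split.
  apply: (big_ind (fun x => c%:E <= x)%E) => [|x y cx cy|[i j] /=].
  - exact: leey.
  - by rewrite le_min cx.
  - by move=> /and3P[_ _ ij]; rewrite lee_fin ct.
apply: (big_ind (fun x => c%:E <= x)%E) => [|x y cx cy|[i j] /=].
- exact: leey.
- by rewrite le_min cx.
- move=> /andP[iin jout]; rewrite lee_fin ct//.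
  by apply: contraNneq iin => ->.
Qed.

Lemma powR_inv4 (x : R) : 0 <= x -> x `^ 4^-1 = Num.sqrt (Num.sqrt x).
Proof.
move=> x0; rewrite -powR12_sqrt// -powR12_sqrt ?powR_ge0// -powRrM.
by congr (_ `^ _); lra.
Qed.

(** The squared separation is [2 * tau ^ 2 * hamming >= tau ^ 2 * d / 4 = sqrt (d * L) / 36]; the
    divisor 3 in [tau] is what produces 36. *)
Lemma separated_kappa (L : R) (eps : {ffun 'I_m * 'I_d -> bool})
    (p : injection n m) :
  0 <= L -> (0 < d)%N -> well_separated eps ->
  (((d%:R * L) `^ 4^-1)%:E <=
   6%:E * kappa (sign_triplet (Num.sqrt (Num.sqrt (L / d%:R)) / 3) eps p))%E.
Proof.
move=> L0 d0 /forallP sep.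
set tau := _ / 3; set c := _ `^ _.
have dR0 : (0 : R) < d%:R by rewrite ltr0n.
suff : ((c / 6)%:E <= kappa (sign_triplet tau eps p))%E.
  move=> /(@lee_wpmul2l _ 6%:E); rewrite lee_fin => /(_ (ler0n _ _)).
  by rewrite -EFinM (_ : 6 * (c / 6) = c)//; field.
apply: le_kappa => i j ij; have /forallP/(_ j) := sep i; rewrite ij /= => dH.
rewrite ler_pdivrMr// separation_sign_triplet /c powR_inv4; last first.
  by rewrite mulr_ge0// ltW.
rewrite (_ : 6 = Num.sqrt (36 : R)); last first.
  by rewrite (_ : 36 = 6 ^+ 2) ?sqrtr_sqr ?ger0_norm//; ring.
rewrite -sqrtrM; last by rewrite !mulr_ge0// sqr_ge0.
apply: ler_wsqrtr.
have tau2 : tau ^+ 2 = Num.sqrt (L / d%:R) / 9.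
  by rewrite /tau exprMn sqr_sqrtr ?sqrtr_ge0//; field.
have -> : d%:R * L = (L / d%:R) * d%:R ^+ 2 by field; rewrite gt_eqF.
rewrite sqrtrM ?divr_ge0// ?(ltW dR0)// sqrtr_sqr ger0_norm ?(ltW dR0)//.
rewrite tau2; set s := Num.sqrt _.
have s0 : 0 <= s by exact: sqrtr_ge0.
have : d%:R <= 8 * (hamming eps i j)%:R :> R by rewrite -natrM ler_nat.
by move=> /(ler_wpM2l s0); lra.
Qed.

End separated_triplet.

(** * Numerical inequalities *)

Section numeric_bounds.
Context {R : realType} {n m d : nat}.
Hypotheses (hnm : (n < m)%N) (hn : (5 <= n)%N).
Local Notation L := (ln ((n * m)%:R : R)).
Hypothesis hd : 16 * L <= d%:R.

Let m6 : (6 <= m)%N. Proof. exact: leq_ltn_trans hn hnm. Qed.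
Let m0 : (0 : R) < m%:R. Proof. by rewrite ltr0n; lia. Qed.

Lemma ln_nm_gt0 : 0 < L.
Proof. by rewrite ln_gt0// ltr1n; move: hnm hn; clear; nia. Qed.

Lemma d_gt0 : (0 < d)%N.
Proof. by rewrite -(ltr0n R); have := ln_nm_gt0; have := hd; lra. Qed.

Lemma not_separated_small : (m ^ 2)%:R * (3 / 4 : R) ^+ d <= 30^-1.
Proof.
have nm0 : (0 : R) < (n * m)%:R by rewrite ltr0n; nia.
(* From [3 / 4 <= exp (- 1 / 4)] and [d / 4 >= 4 * L]. *)
have : (3 / 4 : R) ^+ d <= ((n * m)%:R ^+ 4)^-1.
  apply: (@le_trans _ _ (expR (- (4%:R^-1)) ^+ d)).
    apply: lerXn2r; rewrite ?nnegrE ?expR_ge0//.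
    by apply: le_trans (expR_ge1Dx _); lra.
  rewrite -expRM_natl -[X in X ^+ 4]lnK ?posrE// -expRM_natl -expRN ler_expR.
  by have := hd; rewrite /=; lra.
move=> h; apply: le_trans (ler_wpM2l (ler0n _ _) h) _.
rewrite ler_pdivrMr ?exprn_gt0// mulrC ler_pdivlMr// -natrX -natrM ler_nat.
have : (5 * m <= n * m)%N by rewrite leq_mul.
(* Of the two factors [(n * m) ^ 2], one absorbs [m ^ 2] and the other, at least [30 ^ 2], the
   constant 30. *)
move=> q5; rewrite (expnD _ 2 2) mulnC leq_mul ?leq_exp2r//; last by lia.
by apply: (@leq_trans (30 ^ 2)); rewrite // leq_exp2r//; lia.
Qed.

Lemma correlation_small (tau : R) : tau ^+ 4 = L / d%:R / 81 ->
  (1 + tau ^+ 4) ^+ (n * d) <= (m ^_ n)%:R / 6.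
Proof.
move=> tau4; have d0 : (0 : R) < d%:R by rewrite ltr0n d_gt0.
set X := _ ^+ (n * d).
have X0 : 0 <= X.
  by rewrite exprn_ge0// tau4 addr_ge0// !divr_ge0// ltW// ln_nm_gt0.
have XE : X <= expR (n%:R * L / 81).
  apply: (@le_trans _ _ (expR (tau ^+ 4) ^+ (n * d))).
    rewrite lerXn2r ?nnegrE ?expR_ge0 ?expR_ge1Dx//.
    by rewrite tau4 addr_ge0// !divr_ge0// ltW// ln_nm_gt0.
  rewrite -expRM_natl ler_expR tau4 natrM le_eqVlt; apply/orP; left.
  by apply/eqP; field; rewrite gt_eqF.
have L2 : L <= 2 * ln m%:R.
  rewrite natrM lnM ?posrE ?ltr0n; [|lia|lia].
  rewrite -[2]/(1 + 1) mulrDl !mul1r lerD2r ler_ln ?posrE ?ltr0n ?ler_nat; lia.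
have m36 : (36 : R) <= expR (2 * ln m%:R).
  rewrite expRM_natl lnK ?posrE// -natrX ler_nat expnS expn1.
  by apply: (@leq_mul 6 6).
have mN : expR (n%:R * ln (m%:R : R)) <= (m ^_ n)%:R ^+ 2.
  by rewrite expRM_natl lnK ?posrE// -!natrX ler_nat leq_exp_ffact_sqr// ltnW.
have lnm0 : 0 < ln (m%:R : R) by rewrite ln_gt0// ltr1n; lia.
(* Squaring makes [mN] applicable. With 36 replaced by [m ^ 2] and [L] by [2 * ln m], the exponents
   compare through [2 + 4 * n / 81 <= n], true for [n >= 5]. *)
have key : 36 * X ^+ 2 <= (m ^_ n)%:R ^+ 2.
  apply: le_trans mN.
  apply: (@le_trans _ _ (expR (2 * ln m%:R) * expR (n%:R * L / 81) ^+ 2)).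
    by rewrite ler_pM ?sqr_ge0// lerXn2r ?nnegrE ?expR_ge0.
  rewrite -expRM_natl -expRD ler_expR.
  have n5 : (5 : R) <= n%:R by rewrite ler_nat.
  nra.
rewrite ler_pdivlMr// -(@ler_pXn2r _ 2)// ?nnegrE ?mulr_ge0//.
by apply: le_trans key; rewrite exprMn; lra.
Qed.

End numeric_bounds.

(** * From the Bayes bound to the minimax error *)

Theorem theorem4 (R : realType) (n m d : nat)
    (hnm : (n < m)%N) (hn : (5 <= n)%N) (hd1 : (1 <= d)%N)
    (hd : 16 * ln ((n * m)%:R : R) <= d%:R) :
  ((3^-1 : R)%:E <
     minimax_error [set t : @triplet R n m d |
       (((d%:R * ln (n * m)%:R) `^ 4^-1)%:E <= 6%:E * kappa t)%E])%E.
Proof.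
pose L : R := ln (n * m)%:R.
have L0 : 0 <= L by apply: ltW; exact: ln_nm_gt0.
have d0 : (0 : R) < d%:R by rewrite ltr0n.
pose tau : R := Num.sqrt (Num.sqrt (L / d%:R)) / 3.
have tau4 : tau ^+ 4 = L / d%:R / 81.
  rewrite (_ : 4 = 2 * 2)%N// exprM /tau expr_div_n sqr_sqrtr ?sqrtr_ge0//.
  by rewrite expr_div_n sqr_sqrtr ?divr_ge0//; field; rewrite gt_eqF.
(* An infimum preserves only a weak inequality; the gap between 1/2 and 1/3 makes the final one
   strict. *)
apply: (@lt_le_trans _ _ (2^-1 : R)%:E); first by rewrite lte_fin; lra.
apply: le_ereal_inf_tmp => _ [pihat estim <-]; rewrite leNgt; apply/negP => sup_lt.
have mA p : measurable [set z | pihat z = p] by exact: (estim [set p]).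
have success eps p : well_separated eps ->
    ((2^-1 : R)%:E <= law (sign_triplet tau eps p) [set z | pihat z = p])%E.
  move=> sep; have tC := separated_kappa p L0 hd1 sep.
  have : (law (sign_triplet tau eps p) [set z | pihat z <> p] < (2^-1 : R)%:E)%E.
    apply: le_lt_trans sup_lt; apply: ereal_sup_ubound.
    by exists (sign_triplet tau eps p).
  rewrite (_ : [set z | pihat z <> p] = ~` [set z | pihat z = p])//.
  rewrite probability_setC//.
  case: (law _ _) (fin_num_measure (law (sign_triplet tau eps p)) _ (mA p)) => // r _.
  by rewrite -EFinB lte_fin lee_fin; lra.
set N : R := (m ^_ n)%:R.
have N0 : 0 < N by rewrite ltr0n ffact_gt0 ltnW.
have cardN : (#|{: injection n m}|)%:R = N.
  by rewrite card_sig -cardsE card_inj_ffuns !card_ord.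
(* This upper bound on the summed success probabilities is contradicted by counting the separated
   patterns, each of which succeeds with probability at least 1/2. *)
have := le_sum_law_success tau estim (ltnW hnm).
apply/negP; rewrite -ltNge.
pose G : R := (#|[pred eps : {ffun 'I_m * 'I_d -> bool} | well_separated eps]|)%:R.
have GE : 2 ^+ (m * d) * (29 / 30) <= G.
  pose B : R := (#|[pred eps : {ffun 'I_m * 'I_d -> bool} | ~~ well_separated eps]|)%:R.
  have GB : (2 : R) ^+ (m * d) = G + B.
    rewrite -natrD cardC card_ffun card_bool card_prod !card_ord natrX.
    by [].
  have : B <= 2 ^+ (m * d) / 30.
    apply: le_trans (card_not_separated (R := R)) _.
    by rewrite ler_wpM2l ?exprn_ge0//; exact: not_separated_small hnm hn hd.
  by rewrite GB; lra.
apply: (@lt_le_trans _ _ (N * (G / 2))%:E).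
  rewrite lte_fin.
  have := correlation_small hnm hn hd tau4; rewrite -/N.
  set X := _ ^+ (n * d); have : (0 : R) < 2 ^+ (m * d) by rewrite exprn_gt0.
  move: GE; set p := 2 ^+ (m * d) => GE p0 XN.
  apply: (@lt_le_trans _ _ (N * (p * (29 / 30) / 2))); last first.
    by rewrite ler_wpM2l ?(ltW N0)//; lra.
  apply: (@le_lt_trans _ _ (p * (N / 4 + N / 6))).
    by rewrite ler_wpM2l ?(ltW p0)//; lra.
  (* Here [1 / 4 + 1 / 6 = 25 / 60 < 29 / 60]. *)
  have := mulr_gt0 p0 N0; lra.
apply: (@le_trans _ _ (\sum_(p : injection n m) (G / 2)%:E)%E).
  by rewrite sumEFin sumr_const lee_fin -cardN mulr_natl.
apply: lee_sum => p _.
apply: (@le_trans _ _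
    (\sum_(eps : {ffun 'I_m * 'I_d -> bool} | well_separated eps) (2^-1 : R)%:E)%E).
  by rewrite sumEFin sumr_const lee_fin -[leRHS]mulr_natl.
(* For patterns that are not well separated, the success probability is only bounded below by 0. *)
rewrite big_mkcond; apply: lee_sum => eps _.
by case: ifP => [/success//|_]; exact: measure_ge0.
Qed.
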